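(* Let $f \colon \mathbb{R}^n \to \mathbb{R}$, $g \colon \mathbb{R}^n \to \mathbb{R}^m$, $h \colon \mathbb{R}^n \to \mathbb{R}^p$ be twice continuously differentiable, let $\rho > 0$, let $X := \{ x \in \mathbb{R}^n \mid g(x) \le 0, \ h(x) = 0, \ x \ge 0 \}$, and let $p^\rho(y) = \sum_{i=1}^n p_i^\rho(y_i)$ with each $p_i^\rho$ satisfying (P.1)--(P.2) stated in the context and $p^\rho$ twice continuously differentiable. Let $x^*$ be an S-stationary point of the problem (SPO): $\min_x f(x) + \rho\|x\|_0$ s.t. $x \in X$, with multipliers $(\lambda^*, \mu^* )$, and let $y^* \in \mathbb{R}^n$ be given by $y_i^* = s_i^\rho$ if $x_i^* = 0$ and $y_i^* = 0$ otherwise. Then the following statements are equivalent: (a) SP-SONC holds at $x^*$ for (SPO). (b) SONC holds at $(x^*, y^* )$ for (SPOref). (c) SONC holds at $(x^*, y^* )$ for (SPOcp). The same equivalences also hold for SP-SOSC and SOSC (in place of SP-SONC and SONC) provided that the (diagonal) matrix $\nabla^2 p^\rho(y^* )$ is positive definite.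
   Context: Notation: $\|x\|_0$ is the number of nonzero components of $x$; $I_0(x) := \{ i \mid x_i = 0\}$; $I_g(x) := \{ i \mid g_i(x) = 0\}$; $x \circ y$ is the componentwise product. Conditions on $p_i^\rho \colon \mathbb{R} \to \mathbb{R}$: (P.1) $p_i^\rho$ is convex and attains a unique minimum at some point $s_i^\rho > 0$; (P.2) $p_i^\rho(0) - p_i^\rho(s_i^\rho) = \rho$. SP-Lagrangian: $L^{SP}(x,\lambda,\mu) := f(x) + \lambda^T g(x) + \mu^T h(x)$. S-stationarity: $x^* \in X$ is S-stationary with multipliers $\lambda^* \in \mathbb{R}^m$, $\mu^* \in \mathbb{R}^p$ if $\nabla_{x_i} L^{SP}(x^*,\lambda^*,\mu^* ) = 0$ for all $i \notin I_0(x^* )$, $h(x^* ) = 0$, and $\lambda^* \ge 0$, $g(x^* ) \le 0$, $\lambda^* \circ g(x^* ) = 0$. SP-critical cone: $\mathcal{C}^{SP}(x^*,\lambda^* )$ is the set of $d \in \mathbb{R}^n$ with $\nabla h_j(x^* )^T d = 0$ ($j=1,\dots,p$); $\nabla g_i(x^* )^T d = 0$ ($i \in I_g(x^* )$, $\lambda_i^* > 0$); $\nabla g_i(x^* )^T d \le 0$ ($i \in I_g(x^* )$, $\lambda_i^* = 0$); $d_i = 0$ ($i \in I_0(x^* )$). SP-SONC (sparse second-order necessary condition): $d^T \nabla_{xx}^2 L^{SP}(x^*,\lambda^*,\mu^* ) d \ge 0$ for all $d \in \mathcal{C}^{SP}(x^*,\lambda^* )$. SP-SOSC (sparse second-order sufficiency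 condition): $d^T \nabla_{xx}^2 L^{SP}(x^*,\lambda^*,\mu^* ) d > 0$ for all $d \in \mathcal{C}^{SP}(x^*,\lambda^* ) \setminus \{0\}$. Reformulations in the variables $(x,y) \in \mathbb{R}^n \times \mathbb{R}^n$: (SPOref): $\min f(x) + p^\rho(y)$ s.t. $g(x) \le 0$, $h(x) = 0$, $x \ge 0$, $x \circ y = 0$. (SPOcp): $\min f(x) + p^\rho(y)$ s.t. $g(x) \le 0$, $h(x) = 0$, $x \circ y = 0$, $x \ge 0$, $y \ge 0$. SONC / SOSC for (SPOref) or (SPOcp) at $(x^*,y^* )$ are the standard second-order necessary / sufficient conditions of nonlinear programming: for KKT multipliers at $(x^*,y^* )$ whose components belonging to $g$ and $h$ are $\lambda^*$ and $\mu^*$ (together with some KKT multipliers for the remaining constraints), the Hessian with respect to $(x,y)$ of the full Lagrangian is nonnegative on the standard critical cone (SONC), respectively positive on all nonzero elements of the critical cone (SOSC). The critical cone consists of the directions satisfying the linearized equality constraints, the linearized active inequality constraints with positive multiplier as equalities, and the remaining linearized active inequality constraints as inequalities. *)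

(* Defs.v *)
From HB Require Import structures.
From mathcomp Require Import all_boot all_order all_algebra.
From mathcomp Require Import boolp classical_sets functions reals.
From mathcomp Require Import topology normedtype derive convex.

Set Implicit Arguments.
Unset Strict Implicit.
Unset Printing Implicit Defensive.

Import Order.TTheory GRing.Theory Num.Theory.
Import numFieldNormedType.Exports.

Local Open Scope classical_set_scope.
Local Open Scope ring_scope.

(* Points of R^N are row vectors; x_i is written x 0 i. *)

Section Calculus.
Context {R : realType} {N : nat}.
Implicit Types (f : 'rV[R]_N -> R) (x d : 'rV[R]_N).

Definition partial (i : 'I_N) f : 'rV[R]_N -> R :=
  fun x => 'D_(delta_mx 0 i) f x.

Definition grad f x : 'rV[R]_N := \row_i partial i f x.

Definition hess f x : 'M[R]_N := \matrix_(i, j) partial j (partial i f) x.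

Definition C1 f : Prop :=
  forall i, (forall x, derivable f x (delta_mx 0 i)) /\
            continuous (partial i f).

Definition C2 f : Prop := C1 f /\ forall i, C1 (partial i f).

Definition dotv (u v : 'rV[R]_N) : R := \sum_i u 0 i * v 0 i.

(* d^T A d in column-vector notation *)
Definition quad (A : 'M[R]_N) d : R := (d *m A *m d^T) 0 0.

Definition posdef (A : 'M[R]_N) : Prop := forall d, d != 0 -> 0 < quad A d.

Definition hadamard (u v : 'rV[R]_N) : 'rV[R]_N := \row_i (u 0 i * v 0 i).

Definition lev (u v : 'rV[R]_N) : Prop := forall i, u 0 i <= v 0 i.

Definition zero_set x : {set 'I_N} := [set i | x 0 i == 0]%SET.

End Calculus.

(* min obj z  s.t.  ineq z <= 0, eqc z = 0 *)
Record nlp (R : realType) (N k l : nat) := Nlp {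
  obj : 'rV[R]_N -> R;
  ineq : 'rV[R]_N -> 'rV[R]_k;
  eqc : 'rV[R]_N -> 'rV[R]_l }.

Section NonlinearProgramming.
Context {R : realType} {N k l : nat}.
Implicit Types (P : nlp R N k l) (z d : 'rV[R]_N).
Implicit Types (a : 'rV[R]_k) (b : 'rV[R]_l).

Definition lagrangian P a b z : R :=
  obj P z + dotv a (ineq P z) + dotv b (eqc P z).

Definition kkt P z a b : Prop :=
  [/\ grad (lagrangian P a b) z = 0,
      eqc P z = 0
    & [/\ lev 0 a, lev (ineq P z) 0 & hadamard a (ineq P z) = 0]].

Definition critical_cone P z a d : Prop :=
  [/\ forall j, dotv (grad (fun w => eqc P w 0 j) z) d = 0,
      forall i, ineq P z 0 i = 0 -> 0 < a 0 i ->
        dotv (grad (fun w => ineq P w 0 i) z) d = 0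
    & forall i, ineq P z 0 i = 0 -> a 0 i = 0 ->
        dotv (grad (fun w => ineq P w 0 i) z) d <= 0].

Definition second_order_necessary P z a b : Prop :=
  forall d, critical_cone P z a d -> 0 <= quad (hess (lagrangian P a b) z) d.

Definition second_order_sufficient P z a b : Prop :=
  forall d, critical_cone P z a d -> d != 0 ->
    0 < quad (hess (lagrangian P a b) z) d.

End NonlinearProgramming.

Section SparseOptimization.
Context {R : realType} {n m p : nat}.
Variables (f : 'rV[R]_n -> R) (g : 'rV[R]_n -> 'rV[R]_m).
Variable h : 'rV[R]_n -> 'rV[R]_p.
Implicit Types (x y d : 'rV[R]_n) (lam : 'rV[R]_m) (mu : 'rV[R]_p).

Definition feasible : set 'rV[R]_n :=
  [set x | [/\ lev (g x) 0, h x = 0 & lev 0 x]].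

(* The constraint x >= 0 of the feasible set carries no multiplier here. *)
Definition SP_lagrangian lam mu x : R :=
  f x + dotv lam (g x) + dotv mu (h x).

Definition S_stationary x lam mu : Prop :=
  [/\ feasible x,
      forall i, i \notin zero_set x -> grad (SP_lagrangian lam mu) x 0 i = 0,
      h x = 0
    & [/\ lev 0 lam, lev (g x) 0 & hadamard lam (g x) = 0]].

Definition SP_critical_cone x lam d : Prop :=
  [/\ forall j, dotv (grad (fun w => h w 0 j) x) d = 0,
      forall i, i \in zero_set (g x) -> 0 < lam 0 i ->
        dotv (grad (fun w => g w 0 i) x) d = 0,
      forall i, i \in zero_set (g x) -> lam 0 i = 0 ->
        dotv (grad (fun w => g w 0 i) x) d <= 0
    & forall i, i \in zero_set x -> d 0 i = 0].

Definition SP_SONC x lam mu : Prop :=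
  forall d, SP_critical_cone x lam d ->
    0 <= quad (hess (SP_lagrangian lam mu) x) d.

Definition SP_SOSC x lam mu : Prop :=
  forall d, SP_critical_cone x lam d -> d != 0 ->
    0 < quad (hess (SP_lagrangian lam mu) x) d.

Definition penalty_condition (rho : R) (phi : R -> R) (s : R) : Prop :=
  [/\ convex_function [set: R^o] phi,
      0 < s,
      forall t, phi s <= phi t,
      forall t, (forall u, phi t <= phi u) -> t = s
    & phi 0 - phi s = rho].

Definition separable (pen : 'I_n -> R -> R) y : R := \sum_i pen i (y 0 i).

(* In the reformulations z = (x, y) = row_mx x y. *)
Definition SPOref (pen : 'I_n -> R -> R) : nlp R (n + n) (m + n) (p + n) :=
  Nlp (fun z => f (lsubmx z) + separable pen (rsubmx z))
      (fun z => row_mx (g (lsubmx z)) (- lsubmx z))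
      (fun z => row_mx (h (lsubmx z)) (hadamard (lsubmx z) (rsubmx z))).

Definition SPOcp (pen : 'I_n -> R -> R) : nlp R (n + n) (m + (n + n)) (p + n) :=
  Nlp (fun z => f (lsubmx z) + separable pen (rsubmx z))
      (fun z => row_mx (g (lsubmx z)) (row_mx (- lsubmx z) (- rsubmx z)))
      (fun z => row_mx (h (lsubmx z)) (hadamard (lsubmx z) (rsubmx z))).

(* nu, eta and gam are the multipliers of x >= 0, y >= 0 and x o y = 0. *)

Definition SONC_SPOref pen x y lam mu : Prop :=
  exists nu gam : 'rV[R]_n,
    kkt (SPOref pen) (row_mx x y) (row_mx lam nu) (row_mx mu gam) /\
    second_order_necessary (SPOref pen)
      (row_mx x y) (row_mx lam nu) (row_mx mu gam).

Definition SOSC_SPOref pen x y lam mu : Prop :=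
  exists nu gam : 'rV[R]_n,
    kkt (SPOref pen) (row_mx x y) (row_mx lam nu) (row_mx mu gam) /\
    second_order_sufficient (SPOref pen)
      (row_mx x y) (row_mx lam nu) (row_mx mu gam).

Definition SONC_SPOcp pen x y lam mu : Prop :=
  exists nu eta gam : 'rV[R]_n,
    kkt (SPOcp pen) (row_mx x y) (row_mx lam (row_mx nu eta)) (row_mx mu gam) /\
    second_order_necessary (SPOcp pen)
      (row_mx x y) (row_mx lam (row_mx nu eta)) (row_mx mu gam).

Definition SOSC_SPOcp pen x y lam mu : Prop :=
  exists nu eta gam : 'rV[R]_n,
    kkt (SPOcp pen) (row_mx x y) (row_mx lam (row_mx nu eta)) (row_mx mu gam) /\
    second_order_sufficient (SPOcp pen)
      (row_mx x y) (row_mx lam (row_mx nu eta)) (row_mx mu gam).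

End SparseOptimization.

(* Main.v *)
Require Import Defs.
From mathcomp Require Import all_boot all_order all_algebra.
From mathcomp Require Import boolp functions reals.
From mathcomp Require Import topology normedtype derive.
From mathcomp Require Import ring lra.
Set Implicit Arguments.
Unset Strict Implicit.
Unset Printing Implicit Defensive.

Import Order.TTheory GRing.Theory Num.Theory.
Import numFieldNormedType.Exports.
Local Open Scope ring_scope.

(** The point y is the componentwise complement of x: the two vanish on
complementary index sets, and y_i minimises p_i wherever x_i = 0.  Linearising
x o y = 0 at (x, y) therefore reads y_i d_i = 0 where x_i = 0 and
x_i e_i = 0 where x_i <> 0, that is, d vanishes on the zero set of x and e
vanishes off it.  The directions (d, e) that remain satisfy the linearised sign
constraints x >= 0 and y >= 0 with equality, whatever the multipliers of these
constraints are.  Hence for both reformulations the critical cone is the product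
of the SP-critical cone with the vectors e that vanish where x does not
([critical_cone_SPOref], [critical_cone_SPOcp]).

The Hessian of either Lagrangian has diagonal blocks the Hessian of the
SP-Lagrangian and that of the penalty, and off-diagonal blocks diag(gam), where
gam multiplies x o y = 0 ([hess_reform_lagrangian]).  As d o e = 0 on the cone,
the off-diagonal blocks contribute nothing, and the quadratic form is the sum of
the two separate forms in d and e ([quad_hess_on_cone]).  The penalty form is
nonnegative on the admissible e because e only moves coordinates of y that sit
at a global minimiser ([quad_hess_separable_ge0]), and positive when the Hessian
of the penalty is positive definite.  Taking e = 0 in one direction and adding
the two forms in the other gives the equivalences ([second_order_necessary_iff],
[second_order_sufficient_iff]) for every choice of the multipliers of x >= 0,
y >= 0 and x o y = 0.

It remains to exhibit KKT multipliers.  With zero multipliers for the sign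
constraints, the gradient equation in x at an index where y_i <> 0, and the one
in y where x_i <> 0, can each be solved for gam_i; the other equation at that
index holds by S-stationarity or because y_i minimises p_i
([grad_compl_multiplier]). *)

(** * Vectors split into blocks *)

Lemma dotv_row_mx {R : realType} {k l : nat} (a c : 'rV[R]_k) (b d : 'rV[R]_l) :
  dotv (row_mx a b) (row_mx c d) = dotv a c + dotv b d.
Proof.
rewrite /dotv big_split_ord /=; congr (_ + _); apply: eq_bigr => i _.
  by rewrite !row_mxEl.
by rewrite !row_mxEr.
Qed.

Lemma dotvC {R : realType} {N : nat} (u v : 'rV[R]_N) : dotv u v = dotv v u.
Proof. by apply: eq_bigr => i _; rewrite mulrC. Qed.

Lemma dot0v {R : realType} {N : nat} (u : 'rV[R]_N) : dotv 0 u = 0.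
Proof. by rewrite /dotv big1 // => i _; rewrite mxE mul0r. Qed.

Lemma dotvZl {R : realType} {N : nat} (c : R) (u v : 'rV[R]_N) :
  dotv (c *: u) v = c * dotv u v.
Proof. by rewrite /dotv mulr_sumr; apply: eq_bigr => i _; rewrite mxE mulrA. Qed.

Lemma dotvN {R : realType} {N : nat} (u v : 'rV[R]_N) : dotv u (- v) = - dotv u v.
Proof. by rewrite /dotv -sumrN; apply: eq_bigr => i _; rewrite mxE mulrN. Qed.

Lemma dotv_deltal {R : realType} {N : nat} (k : 'I_N) (d : 'rV[R]_N) :
  dotv (delta_mx 0 k) d = d 0 k.
Proof.
rewrite /dotv (bigD1 k) //= mxE !eqxx mul1r big1 ?addr0 // => j jk.
by rewrite mxE (negPf jk) andbF mul0r.
Qed.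

Lemma delta_mx_lshift {R : realType} {k l : nat} (i : 'I_k) :
  delta_mx 0 (lshift l i) = row_mx (delta_mx 0 i) 0 :> 'rV[R]_(k + l).
Proof.
by apply/rowP => j; rewrite !mxE; case: splitP => j' jj'; rewrite !mxE //=
  -!(inj_eq val_inj) /= jj' // eqn_leq [(_ <= i)%N]leqNgt ltn_addr ?andbF.
Qed.

Lemma delta_mx_rshift {R : realType} {k l : nat} (i : 'I_l) :
  delta_mx 0 (rshift k i) = row_mx 0 (delta_mx 0 i) :> 'rV[R]_(k + l).
Proof.
apply/rowP => j; rewrite !mxE; case: splitP => j' jj'; rewrite !mxE //=
  -!(inj_eq val_inj) /= jj' ?eqn_add2l // eqn_leq [(k + _ <= _)%N]leqNgt.
by rewrite ltn_addr ?andbF.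
Qed.

Lemma hadamard_row_mx {R : realType} {k l : nat} (a c : 'rV[R]_k) (b d : 'rV[R]_l) :
  hadamard (row_mx a b) (row_mx c d) = row_mx (hadamard a c) (hadamard b d).
Proof.
by apply/rowP => i; rewrite mxE; case: (split_ordP i) => j ->;
  rewrite ?row_mxEl ?row_mxEr mxE.
Qed.

Lemma hadamard0v {R : realType} {N : nat} (v : 'rV[R]_N) : hadamard 0 v = 0.
Proof. by apply/rowP => i; rewrite !mxE mul0r. Qed.

Lemma lev_row_mx {R : realType} {k l : nat} (a c : 'rV[R]_k) (b d : 'rV[R]_l) :
  lev a c -> lev b d -> lev (row_mx a b) (row_mx c d).
Proof.
by move=> ac bd i; case: (split_ordP i) => j ->; rewrite ?row_mxEl ?row_mxEr.
Qed.

Lemma lev_oppr0 {R : realType} {N : nat} (v : 'rV[R]_N) : lev 0 v -> lev (- v) 0.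
Proof. by move=> v0 i; have := v0 i; rewrite !mxE oppr_le0. Qed.

Lemma mul_row_diag_col {R : realType} {N : nat} (a u v : 'rV[R]_N) :
  (u *m diag_mx a *m v^T) 0 0 = \sum_i a 0 i * (u 0 i * v 0 i).
Proof. by rewrite mul_mx_diag !mxE; apply: eq_bigr => i _; rewrite !mxE; ring. Qed.

Lemma quad0 {R : realType} {N : nat} (A : 'M[R]_N) : quad A 0 = 0.
Proof. by rewrite /quad !mul0mx mxE. Qed.

(** The off-diagonal blocks couple [d] and [e] only through the products
[d 0 i * e 0 i], which vanish on the critical cones. *)
Lemma quad_row_block {R : realType} {n : nat} (A B : 'M[R]_n)
    (gam d e : 'rV[R]_n) :
  quad (block_mx A (diag_mx gam) (diag_mx gam) B) (row_mx d e) =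
  quad A d + quad B e + \sum_i gam 0 i * (d 0 i * e 0 i) *+ 2.
Proof.
rewrite /quad mul_row_block tr_row_mx mul_row_col !mulmxDl.
rewrite mxE [X in X + _]mxE [X in _ + X]mxE !mul_row_diag_col -addrA addrCA.
rewrite (eq_bigr (fun i => gam 0 i * (d 0 i * e 0 i))) => [|i _]; last by ring.
under [in RHS]eq_bigr do rewrite mulr2n.
by rewrite big_split /=; ring.
Qed.

(** * Directional derivatives *)

(** A directional derivative depends on the function only through its increments
along the direction.  This transports derivatives through linear maps, such as
the projections of (x, y), with partial derivability as the only regularity. *)
Lemma derive_eq_increments {R : realType} {V V' W : normedModType R}
    (F : V -> W) (G : V' -> W) (a v : V) (a' v' : V') :
  (forall t : R, F (t *: v + a) - F a = G (t *: v' + a') - G a') ->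
  (derivable F a v = derivable G a' v') * ('D_v F a = 'D_v' G a').
Proof.
move=> FG; rewrite /derivable /derive.
have -> // : (fun t => t^-1 *: ((F \o shift a) (t *: v) - F a)) =
  (fun t => t^-1 *: ((G \o shift a') (t *: v') - G a')).
by apply/funext => t /=; rewrite FG.
Qed.

Lemma is_derive_eq_increments {R : realType} {V V' W : normedModType R}
    (F : V -> W) (G : V' -> W) (a v : V) (a' v' : V') (l : W) :
  (forall t : R, F (t *: v + a) - F a = G (t *: v' + a') - G a') ->
  is_derive a' v' G l -> is_derive a v F l.
Proof.
move=> FG [dG Gl]; have [dE DE] := derive_eq_increments FG.
by apply: DeriveDef; [rewrite dE | rewrite DE].
Qed.

Lemma is_derive_coord {R : realType} {N : nat} (z v : 'rV[R]_N) (k : 'I_N) :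
  is_derive z v (fun w : 'rV[R]_N => w 0 k) (v 0 k).
Proof.
apply: (@is_derive_eq_increments R _ _ _ _ id _ _ (z 0 k)) => // t.
by rewrite !mxE.
Qed.

Lemma is_derive_dotv {R : realType} {V : normedModType R} {k : nat}
    (a : 'rV[R]_k) (G : V -> 'rV[R]_k) (x v : V) (dG : 'I_k -> R) :
  (forall i, is_derive x v (fun w => G w 0 i) (dG i)) ->
  is_derive x v (fun w => dotv a (G w)) (\sum_i a 0 i * dG i).
Proof.
move=> GP.
have -> : (fun w => dotv a (G w)) = \sum_i (a 0 i *: fun w => G w 0 i).
  by apply/funext => w; rewrite fct_sumE.
by apply: is_derive_sum => i; exact: is_deriveZ.
Qed.

Lemma is_derive_lsubmx {R : realType} {k l : nat} (F : 'rV[R]_k -> R)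
    (x d : 'rV[R]_k) (y e : 'rV[R]_l) (dF : R) :
  is_derive x d F dF ->
  is_derive (row_mx x y) (row_mx d e) (F \o lsubmx) dF.
Proof.
apply: is_derive_eq_increments => t /=.
by rewrite linearD linearZ /= !row_mxKl.
Qed.

Lemma is_derive_rsubmx {R : realType} {k l : nat} (F : 'rV[R]_l -> R)
    (x d : 'rV[R]_k) (y e : 'rV[R]_l) (dF : R) :
  is_derive y e F dF ->
  is_derive (row_mx x y) (row_mx d e) (F \o rsubmx) dF.
Proof.
apply: is_derive_eq_increments => t /=.
by rewrite linearD linearZ /= !row_mxKr.
Qed.

Lemma partial_lsubmx {R : realType} {k l : nat} (F : 'rV[R]_k -> R)
    (z : 'rV[R]_(k + l)) :
  (forall i, partial (lshift l i) (F \o lsubmx) z = partial i F (lsubmx z)) *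
  (forall i, partial (rshift k i) (F \o lsubmx) z = 0).
Proof.
split=> i; rewrite /partial.
  apply: (derive_eq_increments _).2 => t /=.
  by rewrite delta_mx_lshift linearD linearZ /= row_mxKl.
rewrite -(@derive0 _ _ _ F (lsubmx z)).
apply: (derive_eq_increments _).2 => t /=.
by rewrite delta_mx_rshift linearD linearZ /= row_mxKl.
Qed.

Lemma grad_lsubmx {R : realType} {k l : nat} (F : 'rV[R]_k -> R)
    (x : 'rV[R]_k) (y : 'rV[R]_l) :
  grad (fun z => F (lsubmx z)) (row_mx x y) = row_mx (grad F x) 0.
Proof.
apply/rowP => i; rewrite !mxE.
case: splitP => j ij; rewrite !mxE.
  by rewrite (_ : i = lshift l j) ?partial_lsubmx ?row_mxKl //; exact: val_inj.
by rewrite (_ : i = rshift k j) ?partial_lsubmx //; exact: val_inj.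
Qed.

Lemma grad_oppr_coord {R : realType} {N : nat} (k : 'I_N) (z : 'rV[R]_N) :
  grad (fun w => - w 0 k) z = - delta_mx 0 k.
Proof.
apply/rowP => i; rewrite !mxE /partial.
have dk := is_derive_coord z (delta_mx 0 i) k.
by rewrite (@derive_val _ _ _ _ _ _ _ (is_deriveN _)) mxE [k == i]eq_sym.
Qed.

(** * Twice continuous differentiability of the Lagrangian *)

Lemma C1D {R : realType} {N : nat} (F G : 'rV[R]_N -> R) :
  C1 F -> C1 G -> C1 (F + G).
Proof.
move=> CF CG i; have [[dF cF] [dG cG]] := (CF i, CG i); split.
  by move=> x; exact: derivableD.
have -> : partial i (F + G) = partial i F + partial i G.
  by apply/funext => x; rewrite /partial deriveD.
by move=> x; exact: (cvgD (cF x) (cG x)).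
Qed.

Lemma C1Z {R : realType} {N : nat} (c : R) (F : 'rV[R]_N -> R) :
  C1 F -> C1 (c *: F).
Proof.
move=> CF i; have [dF cF] := CF i; split; first by move=> x; exact: derivableZ.
have -> : partial i (c *: F) = c *: partial i F.
  by apply/funext => x; rewrite /partial deriveZ.
by move=> x; exact: (cvgM (cvg_cst c) (cF x)).
Qed.

Lemma C2D {R : realType} {N : nat} (F G : 'rV[R]_N -> R) :
  C2 F -> C2 G -> C2 (F + G).
Proof.
move=> [CF CF'] [CG CG']; split; first exact: C1D.
move=> i; rewrite (_ : partial i (F + G) = partial i F + partial i G).
  exact: C1D.
apply/funext => x.
by rewrite /partial deriveD //; [exact: (CF i).1 | exact: (CG i).1].
Qed.

Lemma C2Z {R : realType} {N : nat} (c : R) (F : 'rV[R]_N -> R) :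
  C2 F -> C2 (c *: F).
Proof.
move=> [CF CF']; split; first exact: C1Z.
move=> i; rewrite (_ : partial i (c *: F) = c *: partial i F); first exact: C1Z.
by apply/funext => x; rewrite /partial deriveZ //; exact: (CF i).1.
Qed.

Lemma C1_cst {R : realType} {N : nat} (c : R) : C1 (cst c : 'rV[R]_N -> R).
Proof.
move=> i; split; first by move=> x; exact: derivable_cst.
rewrite (_ : partial i (cst c) = cst 0); first exact: cst_continuous.
by apply/funext => x; exact: derive_cst.
Qed.

Lemma C2_cst {R : realType} {N : nat} (c : R) : C2 (cst c : 'rV[R]_N -> R).
Proof.
split; first exact: C1_cst.
move=> i; rewrite (_ : partial i (cst c) = cst 0); first exact: C1_cst.
by apply/funext => x; exact: derive_cst.
Qed.

Lemma C2_dotv {R : realType} {N k : nat} (a : 'rV[R]_k)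
    (G : 'rV[R]_N -> 'rV[R]_k) :
  (forall i, C2 (fun w => G w 0 i)) -> C2 (fun w => dotv a (G w)).
Proof.
move=> GC.
have -> : (fun w => dotv a (G w)) = \sum_i (a 0 i *: fun w => G w 0 i).
  by apply/funext => w; rewrite fct_sumE.
elim/big_ind: _ => [|F1 F2|i _]; [exact: C2_cst | exact: C2D | exact: C2Z].
Qed.

Lemma C2_SP_lagrangian {R : realType} {n m p : nat} (f : 'rV[R]_n -> R)
    (g : 'rV[R]_n -> 'rV[R]_m) (h : 'rV[R]_n -> 'rV[R]_p) lam mu :
  C2 f -> (forall i, C2 (fun w => g w 0 i)) ->
  (forall j, C2 (fun w => h w 0 j)) -> C2 (SP_lagrangian f g h lam mu).
Proof.
move=> fC gC hC.
exact: (C2D (C2D fC (C2_dotv lam gC)) (C2_dotv mu hC)).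
Qed.

(** * The separable penalty *)

Lemma derive1_global_min {R : realType} (phi : R -> R) (c : R) :
  (forall t, derivable phi t 1) -> (forall t, phi c <= phi t) ->
  derive1 phi c = 0.
Proof.
move=> dphi cmin; rewrite derive1E; apply: derive_val.
apply: (@derive1_at_min _ phi (c - 1) (c + 1)) => //; first by lra.
by rewrite in_itv /=; lra.
Qed.

(** If the second derivative were negative, the first, which vanishes at [c],
would be negative just to the right of [c], and by the mean value theorem the
function would drop below its minimum. *)
Lemma derive2_global_min_ge0 {R : realType} (phi : R -> R) (c : R) :
  (forall t, derivable phi t 1) -> derivable (derive1 phi) c 1 ->
  (forall t, phi c <= phi t) -> 0 <= derive1 (derive1 phi) c.
Proof.
move=> dphi ddphi cmin; rewrite leNgt; apply/negP; rewrite derive1E => neg.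
have := cvgr_lt _ ddphi _ neg.
rewrite near_withinE => /(_ _)/nbhs_norm0P[e /= e0 He].
have cce : c < c + e / 2 by lra.
have [||u] := @MVT R phi (derive1 phi) c (c + e / 2) cce.
- by move=> u _; rewrite derive1E; exact: derivableP.
- apply: derivable_within_continuous => u _; exact: dphi.
rewrite in_itv /= => /andP[cu uce] phiE.
have phi'u : derive1 phi u < 0.
  have := He (u - c); rewrite /= ger0_norm ?subr_ge0 ?ltW //.
  rewrite scaler1 subrK (derive1_global_min dphi cmin) subr0 subr_eq0 gt_eqF //.
  move=> /(_ _ isT); rewrite /GRing.scale /= pmulr_rlt0 ?invr_gt0 ?subr_gt0 //.
  by apply; lra.
have := cmin (c + e / 2); rewrite -subr_ge0 phiE pmulr_lge0; last by lra.
by rewrite leNgt phi'u.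
Qed.

Lemma separable_increment {R : realType} {n : nat} (pen : 'I_n -> R -> R) y i
    (t : R) :
  separable pen (t *: delta_mx 0 i + y) - separable pen y =
  pen i (t *: 1 + y 0 i) - pen i (y 0 i).
Proof.
rewrite /separable -sumrB (bigD1 i) //= big1 => [|j ji].
  by rewrite !mxE !eqxx addr0.
by rewrite !mxE (negPf ji) andbF mulr0 add0r subrr.
Qed.

Lemma partial_separable {R : realType} {n : nat} (pen : 'I_n -> R -> R) i :
  partial i (separable pen) = fun y => derive1 (pen i) (y 0 i).
Proof.
apply/funext => y; rewrite derive1E.
by apply: (derive_eq_increments _).2 => t; exact: separable_increment.
Qed.

Lemma hess_separable {R : realType} {n : nat} (pen : 'I_n -> R -> R) y :
  hess (separable pen) y = diag_mx (\row_i derive1 (derive1 (pen i)) (y 0 i)).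
Proof.
apply/matrixP => i j; rewrite !mxE partial_separable /partial.
rewrite (_ : 'D_(_) _ _ = 'D_((i == j)%:R) (derive1 (pen i)) (y 0 i)).
  case: eqP => [->|_]; last exact: derive0.
  by rewrite derive1E.
by apply: (derive_eq_increments _).2 => t; rewrite !mxE eqxx.
Qed.

(** Smoothness is assumed of the sum only; restricting to the line through a
constant vector in direction [i] recovers that of each summand. *)
Lemma separable_C2_derivable {R : realType} {n : nat} (pen : 'I_n -> R -> R) :
  C2 (separable pen) ->
  forall i t, derivable (pen i) t 1 /\ derivable (derive1 (pen i)) t 1.
Proof.
move=> [C1p C2p] i t; split.
  have := (C1p i).1 (const_mx t).
  rewrite (derive_eq_increments (G := pen i) (a' := t) (v' := 1) _).1 // => u.
  by rewrite separable_increment mxE.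
have := (C2p i i).1 (const_mx t); rewrite partial_separable.
rewrite (derive_eq_increments (G := derive1 (pen i)) (a' := t) (v' := 1) _).1 //.
by move=> u; rewrite !mxE !eqxx.
Qed.

(** Only the coordinates moved by [e] count, and there the second derivative is
taken at a global minimiser. *)
Lemma quad_hess_separable_ge0 {R : realType} {n : nat} (pen : 'I_n -> R -> R)
    (y e : 'rV[R]_n) :
  C2 (separable pen) ->
  (forall i, e 0 i != 0 -> forall t, pen i (y 0 i) <= pen i t) ->
  0 <= quad (hess (separable pen) y) e.
Proof.
move=> /separable_C2_derivable dpen ymin.
rewrite hess_separable /quad mul_row_diag_col.
apply: sumr_ge0 => i _; rewrite mxE.
have [->|ei] := eqVneq (e 0 i) 0; first by rewrite !mulr0.
apply: mulr_ge0; last exact: sqr_ge0.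
apply: derive2_global_min_ge0 => [t||]; [exact: (dpen i t).1 | | exact: ymin].
exact: (dpen i _).2.
Qed.

(** * The Lagrangian of the reformulations *)

(** Here [L] is the SP-Lagrangian, [P] the penalty, and [nu], [eta], [gam] are the
multipliers of x >= 0, y >= 0 and x o y = 0.  The Lagrangian that has no
constraint y >= 0 is the case [eta = 0], so both reformulations share one
computation of derivatives. *)
Definition reform_lagrangian {R : realType} {n : nat} (L P : 'rV[R]_n -> R)
    (nu eta gam : 'rV[R]_n) (z : 'rV[R]_(n + n)) : R :=
  L (lsubmx z) + P (rsubmx z) - dotv nu (lsubmx z) - dotv eta (rsubmx z)
  + dotv gam (hadamard (lsubmx z) (rsubmx z)).

Lemma is_derive_reform_lagrangian {R : realType} {n : nat} (L P : 'rV[R]_n -> R)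
    nu eta gam (x y d e : 'rV[R]_n) (dL dP : R) :
  is_derive x d L dL -> is_derive y e P dP ->
  is_derive (row_mx x y) (row_mx d e) (reform_lagrangian L P nu eta gam)
    (dL + dP - dotv nu d - dotv eta e
     + \sum_i gam 0 i * (x 0 i * e 0 i + d 0 i * y 0 i)).
Proof.
move=> DL DP.
have Dl F l : is_derive x d F l -> _ := @is_derive_lsubmx _ _ _ F x d y e l.
have Dr F l : is_derive y e F l -> _ := @is_derive_rsubmx _ _ _ F x d y e l.
have Dcoord a (z v : 'rV[R]_n) : is_derive z v (dotv a) (dotv a v).
  exact: (@is_derive_dotv R 'rV[R]_n n a id z v _ (is_derive_coord z v)).
rewrite (_ : reform_lagrangian _ _ _ _ _ = (L \o lsubmx) + (P \o rsubmx)
  - (dotv nu \o lsubmx) - (dotv eta \o rsubmx)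
  + (fun z => dotv gam (hadamard (lsubmx z) (rsubmx z)))); last by [].
have Dbil : is_derive (row_mx x y) (row_mx d e)
    (fun z => dotv gam (hadamard (lsubmx z) (rsubmx z)))
    (\sum_i gam 0 i * (x 0 i * e 0 i + d 0 i * y 0 i)).
  apply: is_derive_dotv => i.
  have := is_deriveM (Dl _ _ (is_derive_coord x d i))
    (Dr _ _ (is_derive_coord y e i)).
  rewrite /= row_mxKl row_mxKr [y 0 i *: _]mulrC.
  rewrite (_ : (_ * _) = (fun w => hadamard (lsubmx w) (rsubmx w) 0 i)) //.
  by apply/funext => w; rewrite mxE.
exact: (is_deriveD (is_deriveB (is_deriveB (is_deriveD (Dl _ _ DL) (Dr _ _ DP))
  (Dl _ _ (Dcoord nu _ _))) (Dr _ _ (Dcoord eta _ _))) Dbil).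
Qed.

Lemma partial_reform_lagrangian {R : realType} {n : nat} (L P : 'rV[R]_n -> R)
    nu eta gam : C1 L -> C1 P ->
  (forall i, partial (lshift n i) (reform_lagrangian L P nu eta gam) =
     fun z => partial i L (lsubmx z) - nu 0 i + gam 0 i * rsubmx z 0 i) *
  (forall i, partial (rshift n i) (reform_lagrangian L P nu eta gam) =
     fun z => partial i P (rsubmx z) - eta 0 i + gam 0 i * lsubmx z 0 i).
Proof.
move=> CL CP.
split=> i; apply/funext => z; rewrite -{1}[z]hsubmxK /partial.
  rewrite delta_mx_lshift.
  have DL := derivableP ((CL i).1 (lsubmx z)).
  rewrite (derive_val (is_derive :=
    is_derive_reform_lagrangian nu eta gam DL (is_derive0 P _))).
  rewrite [dotv _ 0]dotvC dot0v subr0 addr0.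
  rewrite [dotv _ (delta_mx _ _)]dotvC dotv_deltal; congr (_ + _).
  rewrite (bigD1 i) //= big1 => [|j ji]; rewrite !mxE ?eqxx ?(negPf ji) ?andbF.
    by rewrite mulr0 add0r mul1r addr0.
  by rewrite mulr0 mul0r addr0 mulr0.
rewrite delta_mx_rshift.
have DP := derivableP ((CP i).1 (rsubmx z)).
rewrite (derive_val (is_derive :=
  is_derive_reform_lagrangian nu eta gam (is_derive0 L _) DP)).
rewrite [dotv _ 0]dotvC dot0v subr0 add0r.
rewrite [dotv _ (delta_mx _ _)]dotvC dotv_deltal; congr (_ + _).
rewrite (bigD1 i) //= big1 => [|j ji]; rewrite !mxE ?eqxx ?(negPf ji) ?andbF.
  by rewrite mul0r mulr1 !addr0.
by rewrite mulr0 mul0r addr0 mulr0.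
Qed.

Lemma hess_reform_lagrangian {R : realType} {n : nat} (L P : 'rV[R]_n -> R)
    nu eta gam (x y : 'rV[R]_n) : C2 L -> C2 P ->
  hess (reform_lagrangian L P nu eta gam) (row_mx x y) =
  block_mx (hess L x) (diag_mx gam) (diag_mx gam) (hess P y).
Proof.
move=> [CL CL'] [CP CP'].
have part := partial_reform_lagrangian nu eta gam CL CP.
have Dsum (A B : 'rV[R]_(n + n) -> R) (c t : R) (v : 'rV[R]_(n + n)) dA dB :
    is_derive (row_mx x y) v A dA -> is_derive (row_mx x y) v B dB ->
    'D_v (fun z => A z - c + t * B z) (row_mx x y) = dA + t * dB.
  move=> DA DB.
  rewrite -[dA]subr0.
  exact: (derive_val (is_derive :=
    is_deriveD (is_deriveB DA (is_derive_cst c _ _)) (is_deriveZ t DB))).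
have DL i j := derivableP ((CL' i j).1 x).
have DP i j := derivableP ((CP' i j).1 y).
apply/matrixP => a b; rewrite mxE.
case: (split_ordP a) => i ->; case: (split_ordP b) => j ->.
- rewrite block_mxEul part mxE /partial delta_mx_lshift.
  rewrite (Dsum (partial i L \o lsubmx) (fun z => rsubmx z 0 i) _ _ _ _ _
    (is_derive_lsubmx y 0 (DL i j)) (is_derive_rsubmx x _ (is_derive_coord y 0 i))).
  by rewrite mxE mulr0 addr0.
- rewrite block_mxEur part mxE /partial delta_mx_rshift.
  rewrite (Dsum (partial i L \o lsubmx) (fun z => rsubmx z 0 i) _ _ _ _ _
    (is_derive_lsubmx y _ (is_derive0 _ x))
    (is_derive_rsubmx x _ (is_derive_coord y _ i))).
  by rewrite mxE eqxx /= mulr_natr add0r.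
- rewrite block_mxEdl part mxE /partial delta_mx_lshift.
  rewrite (Dsum (partial i P \o rsubmx) (fun z => lsubmx z 0 i) _ _ _ _ _
    (is_derive_rsubmx x _ (is_derive0 _ y))
    (is_derive_lsubmx y _ (is_derive_coord x _ i))).
  by rewrite mxE eqxx /= mulr_natr add0r.
rewrite block_mxEdr part mxE /partial delta_mx_rshift.
rewrite (Dsum (partial i P \o rsubmx) (fun z => lsubmx z 0 i) _ _ _ _ _
  (is_derive_rsubmx x 0 (DP i j)) (is_derive_lsubmx y _ (is_derive_coord x 0 i))).
by rewrite mxE mulr0 addr0.
Qed.

Lemma lagrangian_SPOref {R : realType} {n m p : nat} (f : 'rV[R]_n -> R)
    (g : 'rV[R]_n -> 'rV[R]_m) (h : 'rV[R]_n -> 'rV[R]_p) pen lam mu nu gam :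
  lagrangian (SPOref f g h pen) (row_mx lam nu) (row_mx mu gam) =
  reform_lagrangian (SP_lagrangian f g h lam mu) (separable pen) nu 0 gam.
Proof.
apply/funext => z; rewrite /lagrangian /reform_lagrangian /SP_lagrangian /=.
by rewrite !dotv_row_mx dotvN dot0v; ring.
Qed.

Lemma lagrangian_SPOcp {R : realType} {n m p : nat} (f : 'rV[R]_n -> R)
    (g : 'rV[R]_n -> 'rV[R]_m) (h : 'rV[R]_n -> 'rV[R]_p) pen lam mu nu eta gam :
  lagrangian (SPOcp f g h pen) (row_mx lam (row_mx nu eta)) (row_mx mu gam) =
  reform_lagrangian (SP_lagrangian f g h lam mu) (separable pen) nu eta gam.
Proof.
apply/funext => z; rewrite /lagrangian /reform_lagrangian /SP_lagrangian /=.
by rewrite !dotv_row_mx !dotvN; ring.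
Qed.

Lemma dotv_grad_hadamard {R : realType} {n : nat} (k : 'I_n) (x y d e : 'rV[R]_n) :
  dotv (grad (fun z : 'rV[R]_(n + n) => hadamard (lsubmx z) (rsubmx z) 0 k)
    (row_mx x y)) (row_mx d e) = y 0 k * d 0 k + x 0 k * e 0 k.
Proof.
have Dk (u v : 'rV[R]_n) : 'D_(row_mx u v)
    (fun z : 'rV[R]_(n + n) => hadamard (lsubmx z) (rsubmx z) 0 k) (row_mx x y)
    = x 0 k * v 0 k + y 0 k * u 0 k.
  have D := is_deriveM (is_derive_lsubmx y v (is_derive_coord x u k))
    (is_derive_rsubmx x u (is_derive_coord y v k)).
  have -> : (fun z : 'rV[R]_(n + n) => hadamard (lsubmx z) (rsubmx z) 0 k) =
    ((fun w : 'rV[R]_n => w 0 k) \o lsubmx) *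
    ((fun w : 'rV[R]_n => w 0 k) \o rsubmx).
    by apply/funext => z; rewrite mxE.
  by rewrite (derive_val (is_derive := D)) /= row_mxKl row_mxKr.
have -> : grad (fun z : 'rV[R]_(n + n) => hadamard (lsubmx z) (rsubmx z) 0 k)
    (row_mx x y) = row_mx (y 0 k *: delta_mx 0 k) (x 0 k *: delta_mx 0 k).
  apply/rowP => a; rewrite mxE /partial; case: (split_ordP a) => i ->.
    by rewrite delta_mx_lshift Dk row_mxEl !mxE mulr0 add0r eqxx eq_sym.
  by rewrite delta_mx_rshift Dk row_mxEr !mxE mulr0 addr0 eqxx eq_sym.
by rewrite dotv_row_mx !dotvZl !dotv_deltal.
Qed.

Lemma grad_reform_lagrangian {R : realType} {n : nat} (L P : 'rV[R]_n -> R)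
    nu eta gam (x y : 'rV[R]_n) : C1 L -> C1 P ->
  grad (reform_lagrangian L P nu eta gam) (row_mx x y) =
  row_mx (grad L x - nu + hadamard gam y) (grad P y - eta + hadamard gam x).
Proof.
move=> CL CP; have part := partial_reform_lagrangian nu eta gam CL CP.
apply/rowP => a; rewrite mxE; case: (split_ordP a) => i ->.
  by rewrite part row_mxEl row_mxKl row_mxKr !mxE.
by rewrite part row_mxEr row_mxKl row_mxKr !mxE.
Qed.

(** * Critical cones and second-order conditions *)

Section Cones.
Context {R : realType} {n m p : nat}.
Variables (f : 'rV[R]_n -> R) (g : 'rV[R]_n -> 'rV[R]_m).
Variables (h : 'rV[R]_n -> 'rV[R]_p) (pen : 'I_n -> R -> R).
Variables (x y : 'rV[R]_n) (lam : 'rV[R]_m).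
Hypothesis xy_compl : forall i, (y 0 i == 0) = (x 0 i != 0).

(** The critical cone common to both reformulations. *)
Definition reform_cone (d e : 'rV[R]_n) : Prop :=
  SP_critical_cone g h x lam d /\ forall k, x 0 k != 0 -> e 0 k = 0.

Lemma dotv_grad_lsubmx {k l : nat} (F : 'rV[R]_n -> 'rV[R]_l)
    (G : 'rV[R]_(n + n) -> 'rV[R]_k) i d e :
  dotv (grad (fun z => row_mx (F (lsubmx z)) (G z) 0 (lshift k i)) (row_mx x y))
    (row_mx d e) = dotv (grad (fun w => F w 0 i) x) d.
Proof.
under eq_fun do rewrite row_mxEl.
by rewrite (grad_lsubmx (fun w => F w 0 i)) dotv_row_mx dot0v addr0.
Qed.

Lemma dotv_grad_oppr (k : 'I_(n + n)) (F : 'rV[R]_(n + n) -> R) z v :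
  (forall w, F w = - w 0 k) -> dotv (grad F z) v = - v 0 k.
Proof.
move=> FE; rewrite (_ : F = (fun w => - w 0 k)); last exact/funext.
by rewrite grad_oppr_coord dotvC dotvN dotvC dotv_deltal.
Qed.

(** Strict complementarity of [x] and [y] makes the linearisation of x o y = 0
kill exactly one of [d 0 k], [e 0 k] at each index.  Both reformulations have
these equality constraints. *)
Lemma linearized_equalities d e :
  (forall j, dotv (grad (fun w => eqc (SPOref f g h pen) w 0 j) (row_mx x y))
     (row_mx d e) = 0) <->
  (forall j, dotv (grad (fun w => h w 0 j) x) d = 0) /\
  (forall k, if x 0 k == 0 then d 0 k = 0 else e 0 k = 0).
Proof.
have gXY k : dotv (grad (fun w => eqc (SPOref f g h pen) w 0 (rshift p k))
    (row_mx x y)) (row_mx d e) = y 0 k * d 0 k + x 0 k * e 0 k.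
  by rewrite -dotv_grad_hadamard /=; under eq_fun do rewrite row_mxEr.
split=> [H | [Hh Hxy] j].
  split=> [j|k]; first by have := H (lshift n j); rewrite dotv_grad_lsubmx.
  have := H (rshift p k); rewrite gXY; have := xy_compl k.
  case: (eqVneq (x 0 k) 0) => [-> /negbT y0|x0 /eqP ->].
    by rewrite mul0r addr0 => /eqP; rewrite mulf_eq0 (negPf y0) => /eqP.
  by rewrite mul0r add0r => /eqP; rewrite mulf_eq0 (negPf x0) => /eqP.
case: (split_ordP j) => k ->; first by rewrite dotv_grad_lsubmx.
rewrite gXY; have := Hxy k; have := xy_compl k.
by case: (eqVneq (x 0 k) 0) => [-> _ ->|x0 /eqP -> ->];
  rewrite ?mulr0 ?mul0r addr0.
Qed.

(** At an active bound [x 0 k = 0] the equalities already give [d 0 k = 0], so the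
linearised bound holds with equality whatever the multiplier [nu 0 k] is. *)
Lemma critical_cone_SPOref nu d e :
  critical_cone (SPOref f g h pen) (row_mx x y) (row_mx lam nu) (row_mx d e)
  <-> reform_cone d e.
Proof.
have gX k : dotv (grad (fun w => ineq (SPOref f g h pen) w 0 (rshift m k))
    (row_mx x y)) (row_mx d e) = - d 0 k.
  rewrite (dotv_grad_oppr (k := lshift n k)) ?row_mxEl // => w.
  by rewrite row_mxEr !mxE.
have gE i : ineq (SPOref f g h pen) (row_mx x y) 0 (lshift n i) = g x 0 i.
  by rewrite /= row_mxEl row_mxKl.
have xE k : ineq (SPOref f g h pen) (row_mx x y) 0 (rshift m k) = - x 0 k.
  by rewrite /= row_mxEr row_mxKl mxE.
split.
  case=> /linearized_equalities[Hh Hxy] Hpos Hzero; split; last first.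
    by move=> k /negPf x0; have := Hxy k; rewrite x0.
  split=> // [i|i|k]; rewrite inE => /eqP g0.
  - by have := Hpos (lshift n i); rewrite gE row_mxEl dotv_grad_lsubmx; exact.
  - by have := Hzero (lshift n i); rewrite gE row_mxEl dotv_grad_lsubmx; exact.
  - by have := Hxy k; rewrite g0 eqxx.
case=> -[Hh Hpos Hzero Hd] He; split.
- apply/linearized_equalities; split=> // k.
  by case: eqP => [/eqP x0|/eqP x0]; [apply: Hd; rewrite inE | exact: He].
- move=> a; case: (split_ordP a) => i -> {a}.
    by rewrite gE row_mxEl dotv_grad_lsubmx => g0; apply: Hpos; rewrite inE g0.
  by rewrite xE gX => /eqP; rewrite oppr_eq0 => x0 _; rewrite Hd ?oppr0 // inE.
move=> a; case: (split_ordP a) => i -> {a}.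
  by rewrite gE row_mxEl dotv_grad_lsubmx => g0; apply: Hzero; rewrite inE g0.
by rewrite xE gX => /eqP; rewrite oppr_eq0 => x0 _; rewrite Hd ?oppr0 // inE.
Qed.

(** An active bound [y 0 k = 0] is one with [x 0 k != 0], where the equalities
already give [e 0 k = 0]; so y >= 0 does not cut the cone further. *)
Lemma critical_cone_SPOcp nu eta d e :
  critical_cone (SPOcp f g h pen) (row_mx x y) (row_mx lam (row_mx nu eta))
    (row_mx d e) <-> reform_cone d e.
Proof.
have gE i : ineq (SPOcp f g h pen) (row_mx x y) 0 (lshift (n + n) i) = g x 0 i.
  by rewrite /= row_mxEl row_mxKl.
have xyE k : ineq (SPOcp f g h pen) (row_mx x y) 0 (rshift m k) = - row_mx x y 0 k.
  by rewrite /= row_mxEr -opp_row_mx hsubmxK mxE.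
have gXY k : dotv (grad (fun w => ineq (SPOcp f g h pen) w 0 (rshift m k))
    (row_mx x y)) (row_mx d e) = - row_mx d e 0 k.
  apply: dotv_grad_oppr => w.
  by rewrite /= row_mxEr -opp_row_mx hsubmxK mxE.
split.
  case=> /linearized_equalities[Hh Hxy] Hpos Hzero; split; last first.
    by move=> k /negPf x0; have := Hxy k; rewrite x0.
  split=> // [i|i|k]; rewrite inE => /eqP g0.
  - have := Hpos (lshift (n + n) i).
    by rewrite gE row_mxEl dotv_grad_lsubmx; exact.
  - have := Hzero (lshift (n + n) i).
    by rewrite gE row_mxEl dotv_grad_lsubmx; exact.
  - by have := Hxy k; rewrite g0 eqxx.
case=> -[Hh Hpos Hzero Hd] He.
have Hde k : - row_mx x y 0 k = 0 -> row_mx d e 0 k = 0.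
  move=> /eqP; rewrite oppr_eq0; case: (split_ordP k) => i ->.
    by rewrite !row_mxEl => x0; rewrite Hd // inE.
  by rewrite !row_mxEr xy_compl; exact: He.
split.
- apply/linearized_equalities; split=> // k.
  by case: eqP => [/eqP x0|/eqP x0]; [apply: Hd; rewrite inE | exact: He].
- move=> a; case: (split_ordP a) => i -> {a}.
    by rewrite gE row_mxEl dotv_grad_lsubmx => g0; apply: Hpos; rewrite inE g0.
  by rewrite xyE gXY => /Hde -> _; rewrite oppr0.
move=> a; case: (split_ordP a) => i -> {a}.
  by rewrite gE row_mxEl dotv_grad_lsubmx => g0; apply: Hzero; rewrite inE g0.
by rewrite xyE gXY => /Hde -> _; rewrite oppr0.
Qed.

Section SecondOrder.
Context {k l : nat}.
Variables (P : nlp R (n + n) k l) (a : 'rV[R]_k) (b : 'rV[R]_l).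
Variables (mu : 'rV[R]_p) (nu eta gam : 'rV[R]_n).
Hypothesis cone_P : forall d e,
  critical_cone P (row_mx x y) a (row_mx d e) <-> reform_cone d e.
Hypothesis lagrangian_P : lagrangian P a b =
  reform_lagrangian (SP_lagrangian f g h lam mu) (separable pen) nu eta gam.
Hypothesis L_C2 : C2 (SP_lagrangian f g h lam mu).
Hypothesis pen_C2 : C2 (separable pen).

Lemma quad_hess_on_cone d e : reform_cone d e ->
  quad (hess (lagrangian P a b) (row_mx x y)) (row_mx d e) =
  quad (hess (SP_lagrangian f g h lam mu) x) d + quad (hess (separable pen) y) e.
Proof.
case=> -[_ _ _ d0] e0.
rewrite lagrangian_P hess_reform_lagrangian // quad_row_block big1 ?addr0 // => i _.
have [xi0|xi0] := eqVneq (x 0 i) 0.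
  by rewrite d0 ?inE ?xi0 // mul0r mulr0 mul0rn.
by rewrite e0 // !mulr0 mul0rn.
Qed.

Lemma reform_cone0r d : SP_critical_cone g h x lam d -> reform_cone d 0.
Proof. by move=> dC; split=> // i _; rewrite mxE. Qed.

Lemma quad_hess_on_cone0r d : SP_critical_cone g h x lam d ->
  quad (hess (lagrangian P a b) (row_mx x y)) (row_mx d 0) =
  quad (hess (SP_lagrangian f g h lam mu) x) d.
Proof.
move=> /reform_cone0r/quad_hess_on_cone ->.
by rewrite -[RHS]addr0; congr (_ + _); exact: quad0.
Qed.

Lemma second_order_necessary_iff :
  (forall e : 'rV[R]_n, (forall i, x 0 i != 0 -> e 0 i = 0) ->
     0 <= quad (hess (separable pen) y) e) ->
  second_order_necessary P (row_mx x y) a b <-> SP_SONC f g h x lam mu.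
Proof.
move=> pen_ge0; split=> [nec d dC | nec w].
  rewrite -(quad_hess_on_cone0r dC); apply: nec.
  by apply/cone_P; exact: reform_cone0r.
rewrite -[w]hsubmxK cone_P => wC; rewrite (quad_hess_on_cone wC).
by apply: addr_ge0; [apply: nec; case: wC | apply: pen_ge0; case: wC].
Qed.

(** Of the two parts of a nonzero (d, e) at least one is nonzero, and its
quadratic form supplies the strict inequality. *)
Lemma second_order_sufficient_iff :
  posdef (hess (separable pen) y) ->
  second_order_sufficient P (row_mx x y) a b <-> SP_SOSC f g h x lam mu.
Proof.
move=> pen_gt0; split=> [suf d dC d0 | suf w].
  rewrite -(quad_hess_on_cone0r dC); apply: suf.
    by apply/cone_P; exact: reform_cone0r.
  by apply: contra_neq d0 => /(congr1 lsubmx); rewrite row_mxKl linear0.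
rewrite -[w]hsubmxK cone_P => wC; rewrite (quad_hess_on_cone wC).
have [dC _] := wC.
have [d0 | d0 _] := eqVneq (lsubmx w) 0; last first.
  apply: ltr_wpDr; last exact: suf.
  by have [->|/pen_gt0/ltW//] := eqVneq (rsubmx w) 0; rewrite quad0.
move=> w0; apply: ltr_wpDl; first by rewrite d0 quad0.
by apply: pen_gt0; apply: contra_neq w0; rewrite d0 => ->; rewrite row_mx0.
Qed.

End SecondOrder.
End Cones.

(** * Multipliers of the reformulations *)

Section Kkt.
Context {R : realType} {n m p : nat}.
Variables (f : 'rV[R]_n -> R) (g : 'rV[R]_n -> 'rV[R]_m).
Variables (h : 'rV[R]_n -> 'rV[R]_p) (pen : 'I_n -> R -> R).
Variables (x y : 'rV[R]_n) (lam : 'rV[R]_m) (mu : 'rV[R]_p).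
Hypothesis xy_compl : forall i, (y 0 i == 0) = (x 0 i != 0).
Hypothesis L_C1 : C1 (SP_lagrangian f g h lam mu).
Hypothesis pen_C1 : C1 (separable pen).
Hypothesis x_stat : S_stationary f g h x lam mu.
Hypothesis pen_stat : forall i, x 0 i = 0 -> grad (separable pen) y 0 i = 0.

(** Each entry solves the one gradient equation at its index whose coefficient of
[gam 0 i] is nonzero, with zero multipliers for the sign constraints. *)
Definition compl_multiplier : 'rV[R]_n :=
  \row_i if x 0 i == 0 then - grad (SP_lagrangian f g h lam mu) x 0 i / y 0 i
         else - grad (separable pen) y 0 i / x 0 i.

Lemma grad_compl_multiplier :
  grad (reform_lagrangian (SP_lagrangian f g h lam mu) (separable pen) 0 0
    compl_multiplier) (row_mx x y) = 0.
Proof.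
have [_ L_stat _ _] := x_stat.
rewrite grad_reform_lagrangian // -[RHS]row_mx0 !subr0.
congr row_mx; apply/rowP => i; rewrite mxE [hadamard _ _ _ _]mxE;
  rewrite [compl_multiplier _ _]mxE [RHS]mxE.
  have := xy_compl i; have [x0 /= /negbT y0|x0 /= /eqP y0] := eqVneq (x 0 i) 0.
    by rewrite mulfVK // addrN.
  by rewrite y0 mulr0 addr0 L_stat // inE.
have [x0|x0] := eqVneq (x 0 i) 0; first by rewrite x0 mulr0 addr0 pen_stat.
by rewrite mulfVK // addrN.
Qed.

Lemma hadamard_xy : hadamard x y = 0.
Proof.
apply/rowP => i; rewrite !mxE; have := xy_compl i.
by have [-> _|_ /eqP ->] := eqVneq (x 0 i) 0; rewrite ?mul0r ?mulr0.
Qed.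

Lemma kkt_SPOref :
  kkt (SPOref f g h pen) (row_mx x y) (row_mx lam 0) (row_mx mu compl_multiplier).
Proof.
have [[_ _ x_ge0] _ hx0 [lam_ge0 gx_le0 lam_g]] := x_stat.
rewrite /kkt lagrangian_SPOref /= !row_mxKl !row_mxKr hx0 hadamard_xy.
rewrite hadamard_row_mx hadamard0v lam_g !row_mx0.
split=> //; first exact: grad_compl_multiplier.
by rewrite -!row_mx0; split=> //; apply: lev_row_mx => //; exact: lev_oppr0.
Qed.

Lemma kkt_SPOcp : lev 0 y ->
  kkt (SPOcp f g h pen) (row_mx x y) (row_mx lam (row_mx 0 0))
    (row_mx mu compl_multiplier).
Proof.
have [[_ _ x_ge0] _ hx0 [lam_ge0 gx_le0 lam_g]] := x_stat.
move=> y_ge0; rewrite /kkt lagrangian_SPOcp /= !row_mxKl !row_mxKr hx0 hadamard_xy.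
rewrite !hadamard_row_mx !hadamard0v lam_g !row_mx0.
split=> //; first exact: grad_compl_multiplier.
rewrite -!row_mx0; split=> //; do 2?[apply: lev_row_mx => //].
- exact: lev_oppr0.
- exact: lev_oppr0.
Qed.

End Kkt.

Theorem theorem4p6 (R : realType) (n m p : nat)
  (f : 'rV[R]_n -> R) (g : 'rV[R]_n -> 'rV[R]_m) (h : 'rV[R]_n -> 'rV[R]_p)
  (rho : R) (pen : 'I_n -> R -> R) (s : 'rV[R]_n)
  (x y : 'rV[R]_n) (lam : 'rV[R]_m) (mu : 'rV[R]_p)
  (f_C2 : C2 f)
  (g_C2 : forall i : 'I_m, C2 (fun w => g w 0 i))
  (h_C2 : forall j : 'I_p, C2 (fun w => h w 0 j))
  (rho_gt0 : 0 < rho)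
  (pen_P : forall i : 'I_n, penalty_condition rho (pen i) (s 0 i))
  (pen_C2 : C2 (separable pen))
  (x_stat : S_stationary f g h x lam mu)
  (y_def : forall i : 'I_n, y 0 i = if x 0 i == 0 then s 0 i else 0) :
  ((SP_SONC f g h x lam mu <-> SONC_SPOref f g h pen x y lam mu) /\
   (SP_SONC f g h x lam mu <-> SONC_SPOcp f g h pen x y lam mu)) /\
  (posdef (hess (separable pen) y) ->
   (SP_SOSC f g h x lam mu <-> SOSC_SPOref f g h pen x y lam mu) /\
   (SP_SOSC f g h x lam mu <-> SOSC_SPOcp f g h pen x y lam mu)).
Proof.
have s_gt0 i : 0 < s 0 i by case: (pen_P i).
have xy_compl i : (y 0 i == 0) = (x 0 i != 0).
  by rewrite y_def; have [_|_] := eqVneq (x 0 i) 0; rewrite ?eqxx ?gt_eqF.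
have y_ge0 : lev 0 y.
  by move=> i; rewrite mxE y_def; case: eqP => // _; exact: ltW.
have y_min i : x 0 i = 0 -> forall t, pen i (y 0 i) <= pen i t.
  by move=> x0; rewrite y_def x0 eqxx; case: (pen_P i).
have L_C2 := C2_SP_lagrangian lam mu f_C2 g_C2 h_C2.
have pen_stat i : x 0 i = 0 -> grad (separable pen) y 0 i = 0.
  move=> /y_min ymin; rewrite mxE partial_separable.
  apply: derive1_global_min => // t.
  exact: (separable_C2_derivable pen_C2 i t).1.
have pen_ge0 (e : 'rV[R]_n) : (forall i, x 0 i != 0 -> e 0 i = 0) ->
    0 <= quad (hess (separable pen) y) e.
  move=> e0; apply: quad_hess_separable_ge0 => // i ei; apply: y_min.
  by apply/eqP; apply: contra_neqT ei => /e0.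
have kref := kkt_SPOref xy_compl L_C2.1 pen_C2.1 x_stat pen_stat.
have kcp := kkt_SPOcp xy_compl L_C2.1 pen_C2.1 x_stat pen_stat y_ge0.
have necref nu gam := second_order_necessary_iff
  (@critical_cone_SPOref _ _ _ _ f g h pen x y lam xy_compl nu)
  (lagrangian_SPOref f g h pen lam mu nu gam) L_C2 pen_C2 pen_ge0.
have neccp nu eta gam := second_order_necessary_iff
  (@critical_cone_SPOcp _ _ _ _ f g h pen x y lam xy_compl nu eta)
  (lagrangian_SPOcp f g h pen lam mu nu eta gam) L_C2 pen_C2 pen_ge0.
split; first split.
- split=> [nec | [nu [gam [_ /necref]]] //].
  by do 2!eexists; split; [exact: kref | exact/necref].
- split=> [nec | [nu [eta [gam [_ /neccp]]]] //].
  by do 3!eexists; split; [exact: kcp | exact/neccp].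
move=> pen_gt0.
have sufref nu gam := second_order_sufficient_iff
  (@critical_cone_SPOref _ _ _ _ f g h pen x y lam xy_compl nu)
  (lagrangian_SPOref f g h pen lam mu nu gam) L_C2 pen_C2 pen_gt0.
have sufcp nu eta gam := second_order_sufficient_iff
  (@critical_cone_SPOcp _ _ _ _ f g h pen x y lam xy_compl nu eta)
  (lagrangian_SPOcp f g h pen lam mu nu eta gam) L_C2 pen_C2 pen_gt0.
split.
- split=> [suf | [nu [gam [_ /sufref]]] //].
  by do 2!eexists; split; [exact: kref | exact/sufref].
- split=> [suf | [nu [eta [gam [_ /sufcp]]]] //].
  by do 3!eexists; split; [exact: kcp | exact/sufcp].
Qed.
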